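(* There exists a finite family $\mathcal H$ of signed graphs with $\lambda_1(H^\pm)>\sqrt3$ for each $H^\pm\in\mathcal H$ such that $M_{3,\mathcal H}(\sqrt3,N)\le 3N/7$ for every $N$.
   Context: A signed graph $G^\pm$ is a finite simple graph whose edges are labeled positive or negative; its signed adjacency matrix has entry $1$ for a positive edge, $-1$ for a negative edge, $0$ otherwise; its eigenvalues are $\lambda_1(G^\pm)\ge\lambda_2(G^\pm)\ge\cdots$ and $\mathrm{mult}(\lambda,G^\pm)$ is the multiplicity of $\lambda$. An induced subgraph of a signed graph keeps the edge signs. A valid $t$-coloring is a vertex coloring with $t$ colors such that endpoints of every negative edge get distinct colors and endpoints of every positive edge get the same color; $\chi(G^\pm)$ is the least such $t$ ($\infty$ if none). For a family $\mathcal H$ of signed graphs, $M_{p,\mathcal H}(\lambda,N)$ is the maximum of $\mathrm{mult}(\lambda,G^\pm)$ over all signed graphs $G^\pm$ on at most $N$ vertices containing no member of $\mathcal H$ as an induced subgraph and satisfying $\chi(G^\pm)\le p$ and $\lambda_{p+1}(G^\pm)\le\lambda$. *)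

(* Defs.v *)
From HB Require Import structures.
From mathcomp Require Import all_boot all_order all_algebra.
From mathcomp Require Import boolp reals.
From mathcomp Require Import polyrcf.

Set Implicit Arguments.
Unset Strict Implicit.
Unset Printing Implicit Defensive.

Import Order.TTheory GRing.Theory Num.Theory.
Local Open Scope ring_scope.

(** The label of a pair of vertices is [None] for a non-edge, [Some true] for a
    positive edge and [Some false] for a negative edge.  Up to isomorphism every
    finite vertex set is some ['I_n]; [n = 0] is allowed. *)
Definition simple_labeling n (l : {ffun 'I_n * 'I_n -> option bool}) : bool :=
  [forall i, l (i, i) == None] && [forall i, forall j, l (i, j) == l (j, i)].

Record signed_graph (n : nat) := SignedGraph {
  label : {ffun 'I_n * 'I_n -> option bool};
  _ : simple_labeling label }.

HB.instance Definition _ n := [isSub for @label n].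
HB.instance Definition _ n := [Finite of signed_graph n by <:].

Definition pos_edge n (G : signed_graph n) : rel 'I_n :=
  fun i j => label G (i, j) == Some true.

Definition neg_edge n (G : signed_graph n) : rel 'I_n :=
  fun i j => label G (i, j) == Some false.

Definition signed_adj (R : nzRingType) n (G : signed_graph n) : 'M[R]_n :=
  \matrix_(i, j) if pos_edge G i j then 1 else if neg_edge G i j then -1 else 0.

(** All real roots of the characteristic polynomial in decreasing order, each
    repeated according to its multiplicity ([rootsR] lists the distinct real
    roots increasingly). For a symmetric matrix this is the whole spectrum. *)
Definition real_spectrum (R : rcfType) n (A : 'M[R]_n) : seq R :=
  flatten [seq nseq (mup x (char_poly A)) x | x <- rev (rootsR (char_poly A))].

Definition eigenvalues (R : rcfType) n (G : signed_graph n) : seq R :=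
  real_spectrum (signed_adj R G).

(** [eigval R G k] is the [k]-th largest eigenvalue, counted from [k = 1]; it is
    meaningful only for [1 <= k <= n]; in particular it is [0] for [k > n]. *)
Definition eigval (R : rcfType) n (G : signed_graph n) (k : nat) : R :=
  nth 0 (eigenvalues R G) k.-1.

Definition mult (R : rcfType) n (lam : R) (G : signed_graph n) : nat :=
  count_mem lam (eigenvalues R G).

Definition induced_in k n (H : signed_graph k) (G : signed_graph n) : bool :=
  [exists f : {ffun 'I_k -> 'I_n},
    injectiveb f && [forall i, forall j, label H (i, j) == label G (f i, f j)]].

Definition valid_coloring n (G : signed_graph n) t (c : {ffun 'I_n -> 'I_t}) :=
  [forall i, forall j, (neg_edge G i j ==> (c i != c j)) &&
                       (pos_edge G i j ==> (c i == c j))].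

Definition colorable n (G : signed_graph n) (t : nat) : bool :=
  [exists c : {ffun 'I_n -> 'I_t}, valid_coloring G c].

(** [None] stands for infinity. *)
Definition chi n (G : signed_graph n) : option nat :=
  if pselect (exists t, colorable G t) is left ex then Some (ex_minn ex)
  else None.

Definition chi_le n (G : signed_graph n) (p : nat) : bool :=
  if chi G is Some t then (t <= p)%N else false.

(** When [G] has at most [p] vertices it has no [(p+1)]-st eigenvalue and the
    condition on it is void. *)
Definition admissible (R : rcfType) (p : nat) (Hs : seq {k & signed_graph k})
    (lam : R) n (G : signed_graph n) : bool :=
  [&& all (fun H => ~~ induced_in (tagged H) G) Hs,
      chi_le G p &
      (p < n)%N ==> (eigval R G p.+1 <= lam)].

(** A big maximum over an empty range is [0]. The range is nonempty as soon as
    no member of [Hs] is the graph on no vertices, since that graph is then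
    admissible; this holds when every member has positive [eigval _ _ 1]. *)
Definition max_mult (R : rcfType) (p : nat) (Hs : seq {k & signed_graph k})
    (lam : R) (N : nat) : nat :=
  \max_(n < N.+1) \max_(G : signed_graph n | admissible p Hs lam G) mult lam G.

(* Main.v *)
Require Import Defs.
From HB Require Import structures.
From mathcomp Require Import all_boot all_order all_algebra.
From mathcomp Require Import boolp reals.
From mathcomp Require Import polyrcf complex.
From mathcomp Require Import zify ring lra.

Set Implicit Arguments.
Unset Strict Implicit.
Unset Printing Implicit Defensive.

Import Order.TTheory GRing.Theory Num.Theory.
Local Open Scope ring_scope.

(** The forbidden family consists of all signed graphs on at most five vertices whose
    largest eigenvalue exceeds [sqrt 3].  Avoiding them in a validly 3-colored graph means
    two things.  Triangles are entirely negative.  And a vertex [u] outside an induced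
    claw is orthogonal to the claw's eigenvector [(sqrt 3, signs)], which by
    irrationality means that [u] is not adjacent to the center and that its signed
    adjacencies to the leaves cancel.

    If there is no induced claw, then with [f(x) = (3 - x^2)(x + 2) + 3 x] every vertex
    contributes at least 2 to the trace of [f(A)], degrees are at most 4, and
    [14 - f(x) = (x + 4)(x^2 - 2 x + 2)] is nonnegative on the spectrum.  Since [sqrt 3]
    and [- sqrt 3] have the same multiplicity [k] and opposite images under [f], this
    gives [2 n <= 14 (n - 2 k)].

    A component containing an induced claw is a subgraph of the signed cube up to extra
    edges in one layer.  The full cube is not 3-colorable, and in the other cases an
    eigenvector for [sqrt 3] is determined by its values on a set [S] of at most 3/7 of
    the vertices of the component [C], so induction applies to the complement of [C]. *)

(** * Spectral theorem for real symmetric matrices *)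

Lemma mxrank_diag_le (F : fieldType) n (d : 'rV[F]_n) :
  (\rank (diag_mx d) <= #|[set i | d 0%R i != 0%R]|)%N.
Proof.
rewrite diag_mx_sum_delta (bigID (fun i => d 0 i != 0)) /= addrC big1 ?add0r.
  rewrite cardsE -sum1_card [leqRHS](eq_bigl (fun i => d 0 i != 0)) //.
  elim/big_rec2: _ => [|i m M _ le]; first by rewrite mxrank0.
  apply: leq_trans (mxrank_add _ _) _; apply: leq_add le.
  by rewrite (leq_trans (mxrank_scale _ _)) // mxrank_delta.
by move=> i; rewrite negbK => /eqP ->; rewrite scale0r.
Qed.

(** The lower bound comes from subadditivity of the rank: adding the indicator [d'] of the zero
    entries makes the diagonal matrix invertible, and [d'] itself has rank at most the number of
    zeros. *)
Lemma mxrank_diag (F : fieldType) n (d : 'rV[F]_n) :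
  \rank (diag_mx d) = #|[set i | d 0%R i != 0%R]|.
Proof.
apply/eqP; rewrite eqn_leq mxrank_diag_le /=.
pose d' : 'rV[F]_n := \row_i (d 0 i == 0)%:R.
have r1 : (\rank (diag_mx (d + d')) = n)%N.
  apply: mxrank_unit; rewrite unitmxE det_diag unitfE.
  apply/prodf_neq0 => i _; rewrite !mxE.
  by have [->|nz] := eqVneq (d 0 i) 0; rewrite ?add0r ?oner_eq0 // addr0.
have := mxrank_add (diag_mx d) (diag_mx d'); rewrite -raddfD r1 => le.
have := mxrank_diag_le d'.
have -> : [set i | d' 0 i != 0] = ~: [set i | d 0 i != 0].
  apply/setP => i; rewrite !inE negbK /d' mxE.
  by case: (d 0 i == 0); rewrite ?oner_eq0 ?eqxx.
have := cardsC [set i | d 0 i != 0]; rewrite card_ord -[RHS]r1.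
by move=> eqS leS; rewrite -(leq_add2r #|~: [set i | d 0 i != 0]|) eqS r1 (leq_trans le) ?leq_add2l.
Qed.

(* Stated for an abstract closed field [C] over [R] because unification is slow on
   the several structures carried by [R[i]]. *)
Section SymmetricSpectrum.
Variables (R : rcfType) (C : numClosedFieldType) (f : {rmorphism R -> C}) (g : C -> R).
Hypothesis f_ge0 : forall x, (0 <= f x) = (0 <= x).
Hypothesis gK : forall z, z \is Num.real -> f (g z) = z.
Variables (n : nat) (A : 'M[R]_n).
Hypothesis symA : A^T = A.
Local Notation "M ^t*" := (map_mx Num.conj M^T) (at level 30).

Let f_real x : f x \is Num.real.
Proof. by rewrite realE -oppr_ge0 -rmorphN !f_ge0 oppr_ge0 le_total. Qed.

(** Over [C] the matrix is Hermitian, so it is unitarily diagonalizable with real eigenvalues; [g]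
    carries these back to [R]. *)
Let symmetric_diagonalization :
  exists (P : 'M[C]_n) (s : 'rV[R]_n),
    P *m P ^t* = 1%:M /\ map_mx f A = P ^t* *m diag_mx (map_mx f s) *m P.
Proof.
pose B := map_mx f A.
have Breal : B \is a mxOver Num.real by apply/mxOverP => i j; rewrite mxE.
have Bherm : B \is hermsymmx.
  apply: realsym_hermsym => //; apply/is_hermitianmxP.
  by rewrite expr0 scale1r map_mx_id // /B map_trmx symA.
have /orthomx_spectralP defB := hermitian_normalmx Bherm.
have uP := spectral_unitarymx B.
exists (spectralmx B), (map_mx g (spectral_diag B)); split; first exact/unitarymxP.
have -> : map_mx f (map_mx g (spectral_diag B)) = spectral_diag B.
  apply/rowP => j; rewrite !mxE gK //.
  exact/mxOverP/hermitian_spectral_diag_real.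
by rewrite -invmx_unitary.
Qed.

Lemma symmetric_spectrum_closed :
  exists s : 'rV[R]_n,
    [/\ char_poly A = \prod_i ('X - (s 0 i)%:P),
        forall a, \rank (eigenspace A a) = #|[set i | s 0 i == a]|,
        [/\ \tr A = \sum_i s 0 i, \tr (A *m A) = \sum_i s 0 i ^+ 2 &
            \tr (A *m A *m A) = \sum_i s 0 i ^+ 3] &
        forall (a : R) (x : 'rV[R]_n), (forall i, s 0 i <= a) ->
          (x *m A *m x^T) 0 0 <= a * (x *m x^T) 0 0].
Proof.
have [P [s [PP defA]]] := symmetric_diagonalization.
have PP' : P ^t* *m P = 1%:M by apply: mulmx1C.
have [uP _] := mulmx1_unit PP; have [uP' _] := mulmx1_unit PP'.
pose D := diag_mx (map_mx f s).
have conj_add a : map_mx f (A - a%:M) = P ^t* *m diag_mx (map_mx f (s - const_mx a)) *m P.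
  have aP : P ^t* *m (f a)%:M *m P = (f a)%:M.
    by rewrite scalar_mxC -mulmxA PP' mulmx1.
  rewrite !map_mxB defA map_scalar_mx map_const_mx raddfB /= diag_const_mx.
  by rewrite mulmxBr mulmxBl aP.
exists s; split.
- apply: (map_poly_inj f).
  have -> : map_poly f (char_poly A) = char_poly (map_mx f A) by exact: map_char_poly.
  rewrite rmorph_prod /=.
  have -> : \prod_i map_poly f ('X - (s 0 i)%:P) = char_poly D.
    rewrite char_poly_trig ?diag_mx_is_trig //; apply: eq_bigr => i _.
    by rewrite rmorphB /= map_polyX map_polyC !mxE eqxx mulr1n.
  rewrite defA /char_poly /char_poly_mx !map_mxM.
  set P1 := map_mx polyC (P ^t* ); set P2 := map_mx polyC P.
  have P12 : P1 *m P2 = 1%:M.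
    have /(congr1 (map_mx polyC)) := PP'.
    by rewrite map_mxM map_scalar_mx.
  have -> : 'X%:M - P1 *m map_mx polyC D *m P2 = P1 *m ('X%:M - map_mx polyC D) *m P2.
    by rewrite mulmxBr mulmxBl [P1 *m 'X%:M]scalar_mxC -(mulmxA _ P1) P12 mulmx1.
  by rewrite !det_mulmx mulrAC -det_mulmx P12 det1 mul1r.
- move=> a; rewrite mxrank_ker -(mxrank_map f (A - a%:M)) conj_add.
  rewrite mxrankMfree ?row_free_unit // eqmxMfull ?row_full_unit // mxrank_diag.
  rewrite (_ : [set i | s 0 i == a] = ~: [set i | map_mx f (s - const_mx a) 0 i != 0]).
    by rewrite [RHS]cardsCs setCK card_ord.
  by apply/setP=> i; rewrite !inE !mxE negbK fmorph_eq0 subr_eq0.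
- have mulD (d1 d2 : 'rV[C]_n) : P ^t* *m diag_mx d1 *m P *m (P ^t* *m diag_mx d2 *m P)
      = P ^t* *m diag_mx (\row_i (d1 0 i * d2 0 i)) *m P.
    by rewrite -!mulmxA (mulmxA P) PP mul1mx (mulmxA (diag_mx d1)) mulmx_diag.
  have trD (d : 'rV[C]_n) : \tr (P ^t* *m diag_mx d *m P) = \sum_i d 0 i.
    by rewrite mxtrace_mulC mulmxA PP mul1mx mxtrace_diag.
  split; apply: (fmorph_inj f); rewrite -[LHS]trace_map_mx ?map_mxM defA ?mulD trD;
    rewrite rmorph_sum; apply: eq_bigr => i _; rewrite !mxE //.
    by rewrite -rmorphM.
  by rewrite -!rmorphM -expr2 -exprSr.
- move=> a x les; rewrite -subr_ge0.
  have -> : a * (x *m x^T) 0 0 - (x *m A *m x^T) 0 0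
          = - (x *m (A - a%:M) *m x^T) 0 0.
    by rewrite mulmxBr mulmxBl mul_mx_scalar -scalemxAl !mxE opprB.
  rewrite -f_ge0 rmorphN /=.
  (* In the coordinates [y] of the eigenbasis the form is a sum of squared moduli with coefficients
     [s 0 i - a], none of them positive. *)
  pose y := map_mx f x *m P ^t*.
  have -> : f ((x *m (A - a%:M) *m x^T) 0 0)
          = (y *m diag_mx (map_mx f (s - const_mx a)) *m y ^t*) 0 0.
    have -> : y ^t* = P *m map_mx f x^T.
      rewrite /y trmx_mul map_mxM [X in X *m _]trmxCK.
      congr (_ *m _); apply/matrixP=> i j; rewrite !mxE.
      by exact: conj_Creal.
    transitivity ((map_mx f x *m map_mx f (A - a%:M) *m map_mx f x^T) 0 0).
      by rewrite -!map_mxM [RHS]mxE.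
    by rewrite conj_add /y !mulmxA.
  rewrite mul_mx_diag mxE -sumrN; apply: sumr_ge0 => i _.
  rewrite !mxE mulrAC -mulrN mulr_ge0 ?mul_conjC_ge0 //.
  by rewrite -rmorphN f_ge0 opprB subr_ge0.
Qed.
End SymmetricSpectrum.

Lemma symmetric_spectrum (R : rcfType) n (A : 'M[R]_n) : A^T = A ->
  exists s : 'rV[R]_n,
    [/\ char_poly A = \prod_i ('X - (s 0 i)%:P),
        forall a, \rank (eigenspace A a) = #|[set i | s 0 i == a]|,
        [/\ \tr A = \sum_i s 0 i, \tr (A *m A) = \sum_i s 0 i ^+ 2 &
            \tr (A *m A *m A) = \sum_i s 0 i ^+ 3] &
        forall (a : R) (x : 'rV[R]_n), (forall i, s 0 i <= a) ->
          (x *m A *m x^T) 0 0 <= a * (x *m x^T) 0 0].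
Proof.
move=> symA; apply: (@symmetric_spectrum_closed R R[i] (real_complex R) (@complex.Re R)) => //.
- by move=> x; rewrite ler0c.
- by move=> z zr; exact: RRe_real.
Qed.

(** * From the characteristic polynomial to the listed eigenvalues *)

Lemma mup_prod_XsubC_ord (F : fieldType) n (s : 'rV[F]_n) a :
  mup a (\prod_i ('X - (s 0 i)%:P)) = #|[set i | s 0 i == a]|.
Proof.
rewrite -(big_map (fun i => s 0 i) xpredT (fun y => 'X - y%:P)) mu_prod_XsubC.
by rewrite count_map cardsE cardE size_filter.
Qed.

Section Spectrum.
Variables (R : rcfType) (n : nat) (A : 'M[R]_n).
Let p := char_poly A.

Let p0 : p != 0. Proof. exact/monic_neq0/char_poly_monic. Qed.

(** [rootsR] has no repetition, so at most one block of the flattened list carries the value [a]. *)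
Lemma count_real_spectrum a : (count_mem a (real_spectrum A) <= mup a p)%N.
Proof.
rewrite /real_spectrum count_flatten -map_comp sumnE big_map -/p.
rewrite (eq_bigr (fun x => (x == a) * mup a p)%N) => [|x _]; last first.
  by rewrite [LHS]count_nseq -[pred1 a x]/(x == a); have [->|_] := eqVneq x a; rewrite ?mul0n.
rewrite -big_distrl /= -[leqRHS]mul1n leq_mul2r.
apply/orP; right; have -> r : (\sum_(x <- r) (x == a) = count_mem a r)%N.
  by elim: r => [|x r IH]; rewrite ?big_nil // big_cons IH.
by rewrite count_uniq_mem ?leq_b1 // rev_uniq uniq_roots.
Qed.

(** The reversed root list is decreasing, so its head is at least [y]; the head has positive
    multiplicity and therefore survives as the first entry of the flattened list. *)
Lemma eigval1_gt a y : root p y -> a < y -> a < nth 0 (real_spectrum A) 0.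
Proof.
move=> py ay; have yr : y \in rootsR p.
  by rewrite -(roots_on_rootsR p0) inE /= py.
rewrite /real_spectrum -/p.
have : sorted >%R (rev (rootsR p)) by rewrite rev_sorted; exact: sorted_roots.
have : {subset rev (rootsR p) <= root p}.
  by move=> x; rewrite mem_rev -(roots_on_rootsR p0) => /andP[].
move: yr; rewrite -mem_rev; case: (rev (rootsR p)) => [//|x r] yr rp srt /=.
have : (0 < mup x p)%N by rewrite -XsubC_dvd // dvdp_XsubCl; apply: rp; rewrite inE eqxx.
case: (mup x p) => [//|m] _ /=; apply: lt_le_trans ay _.
move: yr; rewrite inE => /predU1P[-> //|yr].
have := order_path_min (rev_trans lt_trans) srt => /allP/(_ _ yr); exact: ltW.
Qed.
End Spectrum.

Lemma signed_adj_sym (R : nzRingType) n (G : signed_graph n) :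
  (signed_adj R G)^T = signed_adj R G.
Proof.
apply/matrixP=> i j; rewrite !mxE /pos_edge /neg_edge.
case: G => l /= /andP[_ /forallP/(_ i)/forallP/(_ j)/eqP ->] //.
Qed.

Lemma mult_le_rank (R : rcfType) n (G : signed_graph n) (a : R) :
  (mult a G <= \rank (eigenspace (signed_adj R G) a))%N.
Proof.
have [s [defp -> _ _]] := symmetric_spectrum (signed_adj_sym R G).
by rewrite (leq_trans (count_real_spectrum _ _)) // defp mup_prod_XsubC_ord.
Qed.

(** Rayleigh's bound read backwards: were all eigenvalues at most [a], the form could not exceed [a]
    times the squared norm. *)
Lemma eigval1_gt_form (R : rcfType) n (G : signed_graph n) (a : R) (x : 'rV[R]_n) :
  a * (x *m x^T) 0 0 < (x *m signed_adj R G *m x^T) 0 0 -> a < eigval R G 1.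
Proof.
have [s [defp _ _ bnd]] := symmetric_spectrum (signed_adj_sym R G).
move=> ax; have [i ai] : exists i, a < s 0 i.
  apply/existsP; apply: contraLR ax; rewrite negb_exists => /forallP le.
  by rewrite -leNgt; apply: bnd => i; rewrite leNgt.
apply: eigval1_gt ai; rewrite defp; apply/rootP; rewrite horner_prod.
by apply/eqP/prodf_eq0; exists i => //; rewrite !hornerE subrr.
Qed.

(** * Irrationality of [sqrt 3] and conjugate roots of rational polynomials *)

Lemma nat_sqr_neq3 (m n : nat) : (0 < n)%N -> (m ^ 2)%N <> (3 * n ^ 2)%N.
Proof.
(* The exponent of 3 is even on the left and odd on the right. *)
move=> n0 /(congr1 (logn 3)); rewrite lognX lognM ?expn_gt0 ?n0 // lognX.
have -> : logn 3 3 = 1%N by [].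
move=> /(congr1 odd).
by rewrite oddD !oddM.
Qed.

Lemma rat_sqr_neq3 (x : rat) : x ^+ 2 <> 3.
Proof.
move=> x3; pose n := `|numq x|%N; pose d := `|denq x|%N.
have d0 : (0 < d)%N by rewrite absz_gt0 denq_neq0.
apply: (nat_sqr_neq3 (m := n) d0).
have : (numq x) ^+ 2 = 3 * (denq x) ^+ 2.
  apply: (@intr_inj rat); rewrite [RHS]rmorphM [LHS]rmorphXn [in RHS]rmorphXn /=.
  have -> : (numq x)%:~R = x * (denq x)%:~R :> rat.
    by rewrite -{2}(divq_num_den x) mulfVK // intr_eq0 denq_neq0.
  by rewrite exprMn x3.
by move/(congr1 absz); rewrite abszM !abszX.
Qed.

Lemma sqrt3_free (F : numFieldType) (t : F) (a b : rat) :
  t ^+ 2 = 3 -> ratr a + ratr b * t = 0 -> a = 0 /\ b = 0.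
Proof.
move=> t3; have [->|b0] := eqVneq b 0.
  by rewrite rmorph0 mul0r addr0 => /eqP; rewrite fmorph_eq0 => /eqP.
move=> ab; case: (@rat_sqr_neq3 (- a / b)); apply: (fmorph_inj (@ratr F)).
rewrite rmorphXn rmorphM fmorphV rmorphN /= -(addrK (ratr b * t) (ratr a)) ab.
by rewrite sub0r opprK mulrC mulKf ?fmorph_eq0 // t3 ratr_nat.
Qed.

Lemma sqrt3_free_int (F : numFieldType) (t : F) (a b : int) :
  t ^+ 2 = 3 -> a%:~R + b%:~R * t = 0 -> a = 0 /\ b = 0.
Proof.
rewrite -!(ratr_int F) => t3 /(sqrt3_free t3)[/eqP + /eqP].
by rewrite !intr_eq0 => /eqP -> /eqP ->.
Qed.

(** The remainder modulo [X^2 - 3] has degree at most 1 and vanishes at [t], so both of its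
    coefficients are zero by [sqrt3_free]. *)
Lemma dvdp_rat_root_sqrt3 (F : numFieldType) (t : F) (q : {poly rat}) :
  t ^+ 2 = 3 -> root (map_poly ratr q) t -> 'X^2 - 3%:P %| q.
Proof.
move=> t3; set d := 'X^2 - 3%:P.
have sd : size d = 3%N by rewrite size_XnsubC.
have dt : (map_poly (@ratr F) d).[t] = 0.
  by rewrite rmorphB /= map_polyXn map_polyC /= !hornerE t3 ratr_nat subrr.
rewrite {1}(divp_eq q d) rmorphD rmorphM /= rootE !hornerE dt mulr0 add0r.
set r := q %% d; have sr : (size r <= 2)%N.
  by rewrite -ltnS -sd ltn_modp -size_poly_gt0 sd.
have -> : r = (r`_0)%:P + (r`_1)%:P * 'X.
  apply/polyP => i; rewrite coefD coefC coefMX coefC.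
  case: i => [|[|i]] /=; rewrite ?addr0 ?add0r //.
  by rewrite nth_default // (leq_trans sr).
rewrite rmorphD rmorphM /= !map_polyC map_polyX !hornerE /= => /eqP/(sqrt3_free t3)[r0 r1].
have : r = 0.
  apply/polyP => -[|[|i]]; rewrite coef0 //.
  by rewrite nth_default // (leq_trans sr).
by rewrite /r => /eqP.
Qed.

(** Factors [X^2 - 3] are divided out one at a time, each contributing one root to [t] and one to
    [- t]; once none is left, neither is a root. *)
Lemma mup_rat_sqrt3 (F : numFieldType) (t : F) (q : {poly rat}) :
  t ^+ 2 = 3 -> q != 0 ->
  mup t (map_poly ratr q) = mup (- t) (map_poly ratr q).
Proof.
move=> t3; have nt3 : (- t) ^+ 2 = 3 by rewrite sqrrN.
have [m] := ubnP (size q); elim: m q => [|m IH] q sq q0.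
  by exfalso; rewrite ltn0 in sq.
have [dq|ndq] := boolP ('X^2 - 3%:P %| q); last first.
  rewrite (mupNroot (contra (dvdp_rat_root_sqrt3 t3) ndq)).
  by rewrite (mupNroot (contra (dvdp_rat_root_sqrt3 nt3) ndq)).
move: dq => /dvdpP[q' eq'].
have /andP[q'0 d0] : (q' != 0) && ('X^2 - 3%:P != 0 :> {poly rat}).
  by rewrite -negb_or -mulf_eq0 -eq'.
have {}sq : (size q' < m)%N.
  by move: sq; rewrite eq' size_mul // size_XnsubC // addn3 => /ltnW.
have tf (u : F) : u ^+ 2 = 3 -> map_poly (@ratr F) ('X^2 - 3%:P) = ('X - u%:P) * ('X - (- u)%:P).
  move=> u3; rewrite rmorphB /= map_polyXn map_polyC /= ratr_nat -u3 polyCN opprK.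
  by rewrite -subr_sqr rmorphXn.
have q'R : map_poly (@ratr F) q' != 0 by rewrite map_poly_eq0.
have dR : map_poly (@ratr F) ('X^2 - 3%:P) != 0 by rewrite map_poly_eq0.
rewrite eq' rmorphM /= (mupM _ q'R dR) (mupM _ q'R dR) (IH _ sq q'0).
apply: (congr1 (addn _)); rewrite (tf _ t3).
have x0 (x : F) : 'X - x%:P != 0 by rewrite polyXsubC_eq0.
rewrite (mupM _ (x0 _) (x0 _)) (mupM _ (x0 _) (x0 _)).
have mu1 (x y : F) : mup x ('X - y%:P) = (y == x) :> nat.
  by rewrite -['X - _]expr1 mup_XsubCX; case: (y == x).
by rewrite !mu1 !eqxx [_ == t]eq_sym addnC.
Qed.

(** * Signed graphs encoded by a graph and a coloring *)

Section Weights.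
Variables (n : nat) (e : rel 'I_n) (c : 'I_n -> 'I_3).

(** A valid coloring determines the signs, equal colors meaning a positive edge, so [e] and [c]
    together carry the whole signed graph. *)
Definition weight i j : int := if e i j then (if c i == c j then 1 else -1) else 0.

Definition weight_mx (R : pzRingType) : 'M[R]_n := \matrix_(i, j) (weight i j)%:~R.

Definition claw x a b d :=
  [&& [&& e x a, e x b & e x d], [&& ~~ e a b, ~~ e a d & ~~ e b d]
    & [&& a != b, a != d & b != d]].

(* What excluding all signed graphs on at most five vertices with largest
   eigenvalue above [sqrt 3] says about a validly 3-colored one. *)
Record locally_bounded : Prop := LocallyBounded {
  edge_sym : symmetric e;
  edge_irr : irreflexive e;
  triangle_rainbow : forall i j k, e i j -> e j k -> e i k -> c i != c j;
  claw_rule : forall x a b d u, claw x a b d -> u \notin [:: x; a; b; d] ->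
    ~~ e x u /\ weight x a * weight u a + weight x b * weight u b
                + weight x d * weight u d = 0 }.
End Weights.

(** * The claw-free case: local counts and a trace inequality *)

(** The double sum counts every edge twice. Three vertices span at least one edge; among four, a
    single edge would leave an independent triple, so there are at least two. *)
Lemma clawfree_pairs (T : eqType) (e : rel T) (s : seq T) :
  symmetric e -> irreflexive e -> uniq s -> (size s <= 4)%N ->
  (forall a b d, a \in s -> b \in s -> d \in s ->
     a != b -> a != d -> b != d -> [|| e a b, e a d | e b d]) ->
  (2 * size s <= 4 + \sum_(j <- s) \sum_(k <- s) e j k)%N.
Proof.
move=> sym irr; case: s => [|a [|b [|d [|f [|]]]]] //= us _ H; rewrite ?mulnS ?muln0 //.
- move: us; rewrite !inE !negb_or /= !andbT => /andP[/andP[ab ad] bd].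
  have := H a b d; rewrite !inE !eqxx !orbT => /(_ isT isT isT ab ad bd).
  rewrite !big_cons !big_nil !irr (sym b a) (sym d a) (sym d b).
  by case: (e a b) (e a d) (e b d) => [] [] [].
- move: us; rewrite !inE !negb_or /= !andbT => /and3P[/and3P[ab ad af] /andP[bd bf] df].
  have H1 := H a b d; have H2 := H a b f; have H3 := H a d f; have H4 := H b d f.
  rewrite !inE !eqxx !orbT in H1 H2 H3 H4.
  move: (H1 isT isT isT ab ad bd) (H2 isT isT isT ab af bf).
  move: (H3 isT isT isT ad af df) (H4 isT isT isT bd bf df).
  rewrite !big_cons !big_nil !irr (sym b a) (sym d a) (sym d b) (sym f a) (sym f b) (sym f d).
  by case: (e a b) (e a d) (e b d) (e a f) (e b f) (e d f) => [] [] [] [] [] [].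
Qed.

Lemma color_pigeonhole (x y z w : 'I_3) :
  [|| x == y, x == z, x == w, y == z, y == w | z == w].
Proof.
apply: contraT => neq; have us : uniq [:: x; y; z; w].
  by move: neq; rewrite /= !inE !negb_or !andbT -!andbA.
by have := max_card [in [:: x; y; z; w]]; rewrite card_ord (card_uniqP us).
Qed.

Lemma color_others (x : 'I_3) : exists y z : 'I_3, [/\ x != y, x != z & y != z].
Proof.
case: x => [[|[|[|m]]] xm]; last by [].
- by exists 1, 2%:R.
- by exists 0, 2%:R.
- by exists 0, 1.
Qed.

Section ClawFree.
Variables (n : nat) (e : rel 'I_n) (c : 'I_n -> 'I_3).
Hypothesis good : locally_bounded e c.
Hypothesis clawfree : forall x a b d, ~~ claw e x a b d.

Let nb i := [set j | e i j].

Lemma clawfree_independent i (I : {set 'I_n}) :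
  I \subset nb i -> {in I &, forall j k, ~~ e j k} -> (#|I| <= 2)%N.
Proof.
move=> /subsetP sI ind; rewrite leqNgt; apply/negP => /card_gt2P[a [b [d]]].
move=> [[Ia Ib Id] [ab bd da]]; have := clawfree i a b d; rewrite /claw.
have := (sI _ Ia, sI _ Ib, sI _ Id); rewrite !inE => -[[-> ->] ->].
by rewrite !ind // ab bd eq_sym da.
Qed.

(** For a color [r] other than that of [i], the neighbors not colored [r] are independent: an
    adjacent pair would form with [i] a triangle of three colors, with [r] a fourth. So there are at
    most two of them, and two choices of [r] cover all neighbors. *)
Lemma clawfree_degree i : (#|nb i| <= 4)%N.
Proof.
have [p [q [ip iq pq]]] := color_others (c i).
have sub r : (#|[set j in nb i | c j != r]| <= 2)%N \/ r = c i.
  have [->|ir] := eqVneq r (c i); [by right|left].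
  apply: (@clawfree_independent i).
    by apply/subsetP => j; rewrite inE => /andP[].
  move=> j k; rewrite !inE => /andP[ij jr] /andP[ik kr]; apply/negP => jk.
  have := color_pigeonhole (c i) (c j) (c k) r.
  have sym := edge_sym good.
  have := triangle_rainbow good ij jk ik.
  have := triangle_rainbow good ik (etrans (sym _ _) jk) ij.
  have := triangle_rainbow good jk (etrans (sym _ _) ik) (etrans (sym _ _) ij).
  move=> /negPf-> /negPf-> /negPf->.
  by rewrite (negPf jr) (negPf kr) eq_sym (negPf ir).
have [hp|/eqP] := sub p; last by rewrite eq_sym (negPf ip).
have [hq|/eqP] := sub q; last by rewrite eq_sym (negPf iq).
apply: leq_trans (leq_add hp hq); apply: leq_trans (leq_card_setU _ _).
apply/subset_leq_card/subsetP => j; rewrite !inE => -> /=.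
by have [->|] := eqVneq (c j) p; rewrite ?orbT ?pq.
Qed.

Lemma clawfree_nb_pairs i :
  (2 * #|nb i| <= 4 + \sum_(j in nb i) \sum_(k in nb i) e j k)%N.
Proof.
rewrite -big_enum; under eq_bigr => j _ do rewrite -big_enum.
rewrite cardE; apply: clawfree_pairs (edge_sym good) (edge_irr good) (enum_uniq _) _ _.
  by rewrite -cardE clawfree_degree.
move=> a b d; rewrite !mem_enum !inE => ia ib id ab ad bd.
have := clawfree i a b d; rewrite /claw ia ib id ab ad bd andbT /=.
by case: (e a b); case: (e a d); case: (e b d).
Qed.

Let A := weight_mx e c.

Lemma weight_sym i j : weight e c i j = weight e c j i.
Proof. by rewrite /weight (edge_sym good) (eq_sym (c i)). Qed.

Lemma trace_weight (R : pzRingType) : \tr (A R) = 0.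
Proof.
by rewrite /mxtrace big1 // => i _; rewrite mxE /weight (edge_irr good).
Qed.

Lemma trace_weight2 (R : pzRingType) : \tr (A R *m A R) = \sum_i (#|nb i|)%:R.
Proof.
apply: eq_bigr => i _; rewrite mxE -sum1_card natr_sum [RHS]big_mkcond /=.
apply: eq_bigr => j _; rewrite !mxE inE -(weight_sym i) /weight.
by case: (e i j); rewrite ?mul0r //; case: (_ == _); rewrite -intrM.
Qed.

(** A closed walk of length 3 runs around a triangle; its three edges are negative, so it
    contributes [-1]. *)
Lemma trace_weight3 (R : pzRingType) :
  \tr (A R *m A R *m A R) = - (\sum_i \sum_(j in nb i) \sum_(k in nb i) e j k)%:R.
Proof.
rewrite natr_sum -sumrN; apply: eq_bigr => i _; rewrite mxE natr_sum -sumrN.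
transitivity (\sum_j \sum_k A R i j * A R j k * A R k i).
  by rewrite exchange_big; apply: eq_bigr => k _; rewrite mxE big_distrl.
rewrite [RHS]big_mkcond; apply: eq_bigr => j _; rewrite inE.
have [ij|nij] := boolP (e i j); last first.
  by rewrite big1 // => k _; rewrite !mxE /weight (negPf nij) !mul0r.
rewrite natr_sum -sumrN [RHS]big_mkcond; apply: eq_bigr => k _; rewrite inE !mxE.
rewrite (weight_sym k) /weight ij.
have [ik|nik] := boolP (e i k); last by rewrite mulr0.
have [jk|njk] := boolP (e j k); last by rewrite mulr0 mul0r oppr0.
have sym := edge_sym good.
have /negPf-> := triangle_rainbow good ij jk ik.
have /negPf-> := triangle_rainbow good ik (etrans (sym _ _) jk) ij.
have /negPf-> := triangle_rainbow good jk (etrans (sym _ _) ik) (etrans (sym _ _) ij).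
by rewrite -!intrM.
Qed.

(** At a coordinate of largest absolute value, the eigenvector equation bounds the modulus of [a] by
    the degree. *)
Lemma clawfree_eigenvalue_ge (R : realFieldType) (a : R) :
  eigenvalue (A R) a -> - 4 <= a.
Proof.
move=> /eigenvalueP[v vA v0].
have [j0 vj0] : exists j, v 0 j != 0.
  by apply/existsP; apply: contraNT v0; rewrite negb_exists => /forallP v0;
     apply/eqP/rowP => j; rewrite mxE; apply/eqP; have := v0 j; rewrite negbK.
have [j _ maxj] := @arg_maxP _ _ _ j0 xpredT (fun j => `|v 0 j|) isT.
have vj : 0 < `|v 0 j| by apply: lt_le_trans (maxj j0 isT); rewrite normr_gt0.
suff : `|a| * `|v 0 j| <= 4 * `|v 0 j| by rewrite ler_pM2r // ler_norml => /andP[].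
have /rowP/(_ j) := vA; rewrite !mxE -normrM => <-.
apply: le_trans (ler_norm_sum _ _ _) _.
apply: (@le_trans _ _ (\sum_(i in nb j) `|v 0 j|)); last first.
  rewrite sumr_const -[leLHS]mulr_natl ler_wpM2r ?normr_ge0 //.
  by rewrite (ler_nat R _ 4) clawfree_degree.
rewrite [leRHS]big_mkcond; apply: ler_sum => i _; rewrite !mxE normrM inE weight_sym /weight.
case: (e j i); last by rewrite normr0 mulr0.
by case: (_ == _); rewrite ?normrN1 ?normr1 mulr1; apply: maxj.
Qed.

Lemma clawfree_rank (R : rcfType) :
  (7 * \rank (eigenspace (A R) (Num.sqrt 3)) <= 3 * n)%N.
Proof.
set t := Num.sqrt 3; have t3 : t ^+ 2 = 3 by rewrite sqr_sqrtr.
have symA : (A R)^T = A R by apply/matrixP => i j; rewrite !mxE weight_sym.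
have [s [defp rk [tr1 tr2 tr3] _]] := symmetric_spectrum symA.
have s_ge i : - 4 <= s 0 i.
  apply: clawfree_eigenvalue_ge; rewrite /eigenvalue -mxrank_eq0 rk -lt0n.
  by apply/card_gt0P; exists i; rewrite inE.
set k := \rank _; have kE : k = #|[set i | s 0 i == t]| by rewrite /k rk.
(* The entries are integers, so the characteristic polynomial is rational and treats [t] and [- t]
   alike. *)
have kE' : k = #|[set i | s 0 i == - t]|.
  rewrite kE -!mup_prod_XsubC_ord -defp.
  have -> : char_poly (A R) = map_poly ratr (char_poly (A rat)).
    rewrite map_char_poly; congr char_poly; apply/matrixP => i j.
    by rewrite !mxE; apply/esym/ratr_int.
  by rewrite (mup_rat_sqrt3 t3) // monic_neq0 // char_poly_monic.
(* This is [14 - f], with [g t + g (- t) = 28]. *)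
pose g (x : R) := (x + 4) * (x ^+ 2 - 2 * x + 2).
have gt : g t = 14 - 3 * t.
  rewrite /g t3; transitivity (20 - 3 * t - 2 * t ^+ 2); first by ring.
  by rewrite t3; ring.
have gNt : g (- t) = 14 + 3 * t.
  rewrite /g sqrrN t3; transitivity (20 + 3 * t - 2 * t ^+ 2); first by ring.
  by rewrite t3; ring.
have tpos : 0 < t by rewrite sqrtr_gt0.
have lower : 28 * k%:R <= \sum_i g (s 0 i).
  have -> : 28 * k%:R = (14 - 3 * t) * k%:R + (14 + 3 * t) * k%:R by ring.
  rewrite {1}kE kE' -!sum1_card !natr_sum !mulr_sumr big_mkcond [X in _ + X]big_mkcond.
  rewrite -big_split /=; apply: ler_sum => i _; rewrite !inE !mulr1.
  have [->|_] := eqVneq (s 0 i) t.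
    have -> : (t == - t) = false by rewrite -subr_eq0 opprK gt_eqF ?addr_gt0.
    by rewrite gt addr0.
  have [->|_] := eqVneq (s 0 i) (- t); first by rewrite gNt add0r.
  (* The linear factor is nonnegative by the bound [- 4] on the spectrum, and the quadratic one is
     [(x - 1)^2 + 1]. *)
  by rewrite addr0 /g mulr_ge0 //; have := s_ge i; [lra|nra].
have upper : \sum_i g (s 0 i) <= 12 * n%:R.
  (* Since [g x = 8 - 6 x + 2 x^2 + x^3], a vertex accounts for 8, plus twice its degree, minus the
     ordered adjacent pairs of its neighbors; [clawfree_nb_pairs] bounds this by 12. *)
  have -> : \sum_i g (s 0 i) = \sum_(i < n) (8 : R) - 6 * \tr (A R)
    + 2 * \tr (A R *m A R) + \tr (A R *m A R *m A R).
    rewrite tr1 tr2 tr3 !mulr_sumr -sumrB -!big_split; apply: eq_bigr => i _ /=.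
    by rewrite /g; ring.
  rewrite trace_weight trace_weight2 trace_weight3 mulr0 subr0 natr_sum -sumrN.
  rewrite mulr_sumr -!big_split /=.
  have -> : 12 * n%:R = \sum_(i < n) (12 : R) by rewrite sumr_const card_ord mulr_natr.
  apply: ler_sum => i _; have := clawfree_nb_pairs i.
  by rewrite -(ler_nat R) natrM natrD; lra.
have : 28 * k%:R <= 12 * n%:R :> R by apply: le_trans lower upper.
by rewrite -!natrM ler_nat; lia.
Qed.
End ClawFree.

(** * The component of an induced claw, layer by layer *)

Section ClawComponent.
Variables (n : nat) (e : rel 'I_n) (c : 'I_n -> 'I_3).
Hypothesis good : locally_bounded e c.
Let sym := edge_sym good.
Local Notation wt := (weight e c).

(** Each leaf adjacent to [u] contributes a sign to a vanishing sum, so the number of such leaves is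
    even. *)
Lemma claw_parity x a b d u :
  claw e x a b d -> u \notin [:: x; a; b; d] ->
  ~~ e x u /\ e u a (+) e u b (+) e u d = false.
Proof.
move=> cl uo; have [xu] := claw_rule good cl uo; rewrite /weight => par; split=> //.
move: par.
case/and3P: cl => /and3P[-> -> ->] _ _.
by case: (e u a) (e u b) (e u d) => [] [] [] //=; do ?case: (_ == _).
Qed.

Lemma claw_rot x a b d : claw e x a b d -> claw e x b d a.
Proof.
case/and3P => /and3P[xa xb xd] /and3P[ab ad bd] /and3P[nab nad nbd].
by rewrite /claw xa xb xd (sym b a) (sym d a) ab ad bd nbd eq_sym nab eq_sym nad.
Qed.

Lemma claw_uniq x a b d : claw e x a b d -> uniq [:: x; a; b; d].
Proof.
case/and3P => /and3P[xa xb xd] _ /and3P[nab nad nbd].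
have ne y : e x y -> x != y by apply: contraL => /eqP <-; rewrite (edge_irr good).
by rewrite /= !inE !negb_or !ne // nab nad nbd.
Qed.

(* Two outside vertices with the same two leaves would either form a claw centred
   at a leaf, or be adjacent and then force both leaves to have the same color. *)
Lemma claw_share x p q r u u' :
  claw e x p q r -> u \notin [:: x; p; q; r] -> u' \notin [:: x; p; q; r] ->
  e u p -> e u q -> e u' p -> e u' q -> u = u'.
Proof.
move=> cl uo uo' up uq up' uq'; apply/eqP; apply: contraT => nuu.
have [xu _] := claw_parity cl uo; have [xu' _] := claw_parity cl uo'.
have [xp [xq pq]] : e x p /\ e x q /\ ~~ e p q.
  by case/and3P: cl => /and3P[-> -> _] /and3P[-> _ _].
have := claw_uniq cl; rewrite /= !inE !negb_or !andbT => /and3P[/and3P[nxp nxq _] /andP[npq _] _].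
have uo0 := uo; move: uo uo'; rewrite !inE !negb_or => /and4P[ux upn uqn _] /and4P[ux' upn' uqn' _].
have [uu|nuu'] := boolP (e u u').
  have upc := triangle_rainbow good up (etrans (sym _ _) up') uu.
  have u'pc := triangle_rainbow good up' (etrans (sym _ _) up) (etrans (sym _ _) uu).
  have uqc := triangle_rainbow good uq (etrans (sym _ _) uq') uu.
  have u'qc := triangle_rainbow good uq' (etrans (sym _ _) uq) (etrans (sym _ _) uu).
  have uuc := triangle_rainbow good uu up' up.
  have /eqP pqc : c p == c q.
    have := color_pigeonhole (c u) (c u') (c p) (c q).
    by rewrite (negPf upc) (negPf u'pc) (negPf uqc) (negPf u'qc) (negPf uuc).
  (* As [p] and [q] have the same color, the two surviving terms of the claw relation are equal and
     cannot cancel. *)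
  have [_ par] := claw_parity cl uo0; have [_ ] := claw_rule good cl uo0.
  move: par; rewrite up uq /= => ur; rewrite /weight xp xq up uq ur pqc mulr0 addr0.
  by case: (_ == _); case: (_ == _).
have cl' : claw e p x u u'.
  rewrite /claw (sym p x) (sym p u) (sym p u') xp up up' xu xu' nuu' nuu.
  by rewrite ![x == _]eq_sym ux ux'.
have qo : q \notin [:: p; x; u; u'].
  by rewrite !inE !negb_or ![q == _]eq_sym npq nxq uqn uqn'.
(* [q] is adjacent to all three leaves of the new claw, against parity. *)
by have [_] := claw_parity cl' qo; rewrite (sym q x) (sym q u) (sym q u') xq uq uq'.
Qed.

Variables (x a b d : 'I_n).
Hypothesis cl : claw e x a b d.

Definition claw_set := [set x; a; b; d].
Definition second_layer := [set u | (u \notin claw_set) && [|| e u a, e u b | e u d]].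
Definition third_layer := [set w | [&& w \notin claw_set, w \notin second_layer
                                 & [exists v in second_layer, e w v]]].
Let V := second_layer.
Let W := third_layer.

Let in_claw u : (u \in claw_set) = (u \in [:: x; a; b; d]).
Proof. by rewrite !inE -!orbA. Qed.

Let in_claw_rot u : (u \in claw_set) = (u \in [:: x; b; d; a]).
Proof. by rewrite !inE -!orbA; congr (_ || _); rewrite orbC -orbA. Qed.

Let in_claw_rot2 u : (u \in claw_set) = (u \in [:: x; d; a; b]).
Proof. by rewrite !inE -!orbA; congr (_ || _); rewrite orbA orbC. Qed.

Lemma second_layer_leaves u : u \in V ->
  [|| [&& ~~ e u a, e u b & e u d], [&& e u a, ~~ e u b & e u d] | [&& e u a, e u b & ~~ e u d]].
Proof.
rewrite inE in_claw => /andP[uo]; have [_] := claw_parity cl uo.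
by case: (e u a) (e u b) (e u d) => [] [] [].
Qed.

Lemma second_layer_share u u' : u \in V -> u' \in V -> u != u' ->
  [&& ~~ [&& e u a, e u b, e u' a & e u' b], ~~ [&& e u b, e u d, e u' b & e u' d]
    & ~~ [&& e u d, e u a, e u' d & e u' a]].
Proof.
rewrite inE => /andP[uo _]; rewrite inE => /andP[uo' _] /eqP nuu.
apply/and3P; split; apply/negP => /and4P[h1 h2 h3 h4]; case: nuu.
- by apply: (claw_share cl); rewrite -?in_claw.
- by apply: (claw_share (claw_rot cl)); rewrite -?in_claw_rot.
- by apply: (claw_share (claw_rot (claw_rot cl))); rewrite -?in_claw_rot2.
Qed.

(** A vertex of the second layer is adjacent to exactly two leaves; recording the third one embeds
    the layer into the set of leaves. *)
Let missing u := if ~~ e u a then a else if ~~ e u b then b else d.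

Let missing_inj : {in V &, injective missing}.
Proof.
move=> u u' uV uV'; have := claw_uniq cl; rewrite /= !inE !negb_or !andbT.
move=> /and3P[_ /andP[nab nad] nbd].
apply: contra_eq => nuu; move: (second_layer_share uV uV' nuu).
move: (second_layer_leaves uV) (second_layer_leaves uV'); rewrite /missing.
case: (e u a) (e u b) (e u d) (e u' a) (e u' b) (e u' d) => [] [] [] [] [] [] //=;
  by rewrite ?nab ?nad ?nbd // eq_sym ?nab ?nad ?nbd.
Qed.

Let card_leaves : (#|[set a; b; d]| <= 3)%N.
Proof.
apply: leq_trans (leq_card_setU _ _) _; rewrite cards1 addn1 ltnS.
by apply: leq_trans (leq_card_setU _ _) _; rewrite !cards1.
Qed.

Lemma card_second_layer : (#|V| <= 3)%N.
Proof.
rewrite -(card_in_imset missing_inj).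
apply: leq_trans (subset_leq_card (_ : _ \subset [set a; b; d])) _.
  by apply/subsetP => _ /imsetP[u _ ->]; rewrite /missing; do 2?case: ifP; rewrite !inE eqxx ?orbT.
exact: card_leaves.
Qed.

Lemma second_layer_full r : (2 < #|V|)%N -> r \in [set a; b; d] ->
  exists2 v, v \in V & ~~ e v r.
Proof.
move=> V3 rL; have sub : missing @: V \subset [set a; b; d].
  by apply/subsetP => _ /imsetP[u _ ->]; rewrite /missing; do 2?case: ifP; rewrite !inE eqxx ?orbT.
have : missing @: V == [set a; b; d].
  rewrite eqEcard sub (card_in_imset missing_inj) (leq_trans card_leaves) //.
move=> /eqP/setP/(_ r); rewrite rL => /imsetP[v vV rE]; exists v => //.
move: rE (second_layer_leaves vV); rewrite /missing.
by case E : (e v a); case F : (e v b); case G : (e v d) => //= ->; rewrite ?E ?F ?G.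
Qed.

(** The two leaves adjacent to [v] form with [w] a claw centered at [v]. The leaves are renamed so
    that [r] is the one [v] misses, which lets later arguments avoid three symmetric cases. *)
Lemma third_layer_claw w v : w \in W -> v \in V -> e w v ->
  exists p q r, [/\ claw e x p q r, claw_set =i [:: x; p; q; r], claw e v p q w & e v p && e v q].
Proof.
move=> wW vV wv; move: (wW); rewrite inE => /and3P[wo wV _].
have : [&& ~~ e w a, ~~ e w b & ~~ e w d].
  by move: wV; rewrite inE wo /= !negb_or.
move=> /and3P[wa wb wd]; move: (wo); rewrite in_claw !inE !negb_or.
move=> /and4P[_ nwa nwb nwd].
have /and3P[/and3P[xa xb xd] /and3P[ab ad bd] /and3P[nab nad nbd]] := cl.
have := second_layer_leaves vV; case/or3P => /and3P[va vb vd].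
- exists b, d, a; split=> //; rewrite ?vb ?vd //; first exact: claw_rot.
  rewrite /claw vb vd (sym v w) wv bd (sym b w) wb (sym d w) wd nbd.
  by rewrite ![_ == w]eq_sym nwb nwd.
- exists d, a, b; split=> //; rewrite ?va ?vd //; first exact/claw_rot/claw_rot.
  rewrite /claw va vd (sym v w) wv (sym d a) ad (sym d w) wd (sym a w) wa.
  by rewrite ![_ == w]eq_sym nwa nwd eq_sym nad.
- exists a, b, d; split=> //; rewrite ?va ?vb //.
  rewrite /claw va vb (sym v w) wv ab (sym a w) wa (sym b w) wb nab.
  by rewrite ![_ == w]eq_sym nwa nwb.
Qed.

(** Let [u] be a neighbor of [w] in the second layer, with leaves [p] and [q]. By [claw_share], a
    different [v] is adjacent to exactly one of [p] and [q], so parity at the claw centered at [u]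
    makes it adjacent to [w]. *)
Lemma third_layer_complete w v : w \in W -> v \in V -> e w v.
Proof.
move=> wW vV; move: (wW); rewrite inE => /and3P[wo wV /existsP[u /andP[uV wu]]].
have [<-//|nuv] := eqVneq u v.
have [p [q [r [clx E clu /andP[up uq]]]]] := third_layer_claw wW uV wu.
have out y : y \in V -> y \notin [:: x; p; q; r] by rewrite inE E => /andP[].
have nvw : v != w by apply: contraTneq vV => ->.
have vo : v \notin [:: u; p; q; w].
  have := out _ vV; rewrite !inE !negb_or => /and4P[_ -> -> _].
  by rewrite eq_sym nuv nvw.
have [_] := claw_parity clu vo; have [_] := claw_parity clx (out _ vV).
have npq : ~~ (e v p && e v q).
  apply: contra nuv => /andP[vp vq]; apply/eqP.
  exact: (claw_share clx (out _ uV) (out _ vV)).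
have : [|| e v p, e v q | e v r].
  move: (vV); rewrite inE => /andP[_].
  have Ep : perm_eq [:: x; a; b; d] [:: x; p; q; r].
    apply: uniq_perm; [exact: claw_uniq cl | exact: claw_uniq clx | move=> y].
    by rewrite -in_claw E.
  have : perm_eq [:: a; b; d] [:: p; q; r] by move: Ep; rewrite perm_cons.
  move=> /perm_mem Em; case/or3P => h.
  - have := Em a; rewrite !inE eqxx => /esym/or3P[] /eqP <-; by rewrite h ?orbT.
  - have := Em b; rewrite !inE eqxx orbT => /esym/or3P[] /eqP <-; by rewrite h ?orbT.
  - have := Em d; rewrite !inE eqxx !orbT => /esym/or3P[] /eqP <-; by rewrite h ?orbT.
rewrite (sym w v); move: npq.
by case: (e v p) (e v q) (e v r) (e v w) => [] [] [] [].
Qed.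

(** A neighbor outside the second layer would meet the claw [v; p, q, w] in the leaf [w] only, an
    odd number. *)
Lemma third_layer_nb w u : w \in W -> e w u -> u \in V.
Proof.
move=> wW wu; move: (wW); rewrite inE => /and3P[wo wV /existsP[v /andP[vV wv]]].
have [p [q [r [clx E clv /andP[vp vq]]]]] := third_layer_claw wW vV wv.
apply: contraT => uV.
have xw : ~~ e x w by move: wo; rewrite in_claw => wo; have [] := claw_parity cl wo.
have wl : ~~ [|| e w a, e w b | e w d] by move: wV; rewrite inE wo.
have uo : u \notin claw_set.
  rewrite in_claw; apply/negP; rewrite !inE => /or4P[] /eqP uE; move: wu wl; rewrite uE.
  - by rewrite sym (negPf xw).
  - by move->.
  - by move->; rewrite orbT.
  - by move->; rewrite !orbT.
have ul : ~~ [|| e u a, e u b | e u d] by move: uV; rewrite inE uo.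
have leaf y : y \in [:: x; p; q; r] -> y != x -> ~~ e u y.
  by rewrite -E in_claw !inE => /or4P[] /eqP -> yx; move: yx ul;
    rewrite ?eqxx // !negb_or => _ /and3P[].
have := claw_uniq clx; rewrite /= !inE !negb_or => /and4P[/and3P[nxp nxq _] _ _ _].
have nup : ~~ e u p by apply: leaf; rewrite ?inE ?eqxx ?orbT // eq_sym.
have nuq : ~~ e u q by apply: leaf; rewrite ?inE ?eqxx ?orbT // eq_sym.
have uo' : u \notin [:: v; p; q; w].
  move: uo; rewrite E !inE !negb_or => /and4P[_ -> -> _] /=.
  apply/andP; split; first by apply: contraNneq uV => ->.
  by apply: contraTneq wu => ->; rewrite (edge_irr good).
have [_] := claw_parity clv uo'.
by rewrite (negPf nup) (negPf nuq) (sym u w) wu.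
Qed.

Definition claw_closure := claw_set :|: V :|: W.

Let in_closure k : (k \in claw_closure) = [|| k \in claw_set, k \in V | k \in W].
Proof. by rewrite [LHS]in_setU [in LHS]in_setU orbA. Qed.

(** The third layer has neighbors only in the second, so the exploration from the claw stops
    there. *)
Lemma claw_closed i j : i \in claw_closure -> e i j -> j \in claw_closure.
Proof.
have step k : e k j -> (k \in claw_set) || (k \in V) -> j \in claw_closure.
  move=> kj; rewrite in_closure; have [//|jK] := boolP (j \in claw_set).
  have [//|jV] := boolP (j \in V); rewrite [j \in W]inE jK jV /=.
  case/orP => [|kV]; last by apply/existsP; exists k; rewrite kV sym.
  have jl : ~~ [|| e j a, e j b | e j d] by move: jV; rewrite inE jK.
  have xj : ~~ e x j by move: jK; rewrite in_claw => jK; have [] := claw_parity cl jK.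
  rewrite in_claw !inE => /or4P[] /eqP kE; move: kj jl; rewrite kE sym.
  - by rewrite sym (negPf xj).
  - by move->.
  - by move->; rewrite orbT.
  - by move->; rewrite !orbT.
rewrite in_closure orbA => /orP[iK|iW] ij; first exact: step ij iK.
by rewrite in_closure (third_layer_nb iW ij) orbT.
Qed.

(** For a 4-cycle colored [p, q, r, s], this says that an odd number of edges are monochromatic,
    that is, that the product of the four weights is [-1]. Colors are naturals here so that the
    check over all colorings computes. *)
Let odd_face (p q r s : nat) := (p == q) (+) (r == q) (+) (p == s) (+) (r == s).

Let odd_face_weight i j k l : e i j -> e k j -> e i l -> e k l ->
  wt i j * wt k j + wt i l * wt k l = 0 -> odd_face (c i) (c j) (c k) (c l).
Proof.
rewrite /weight /odd_face => -> -> -> ->; rewrite -!val_eqE /=.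
by case: (_ == _); case: (_ == _); case: (_ == _); case: (_ == _).
Qed.

Let cube_uncolorable (cx ca cb cd cA cB cD cw : 'I_3) :
  ~ [&& odd_face cx cb cA cd, odd_face cx ca cB cd, odd_face cx ca cD cb,
        odd_face cA cd cB cw, odd_face cA cb cD cw & odd_face cB ca cD cw].
Proof.
(* The check is exhaustive; each face is tested as soon as its four colors are chosen, which prunes
   the search. *)
pose al P := all P (iota 0 3).
have chk : al (fun x => al (fun a => al (fun b => al (fun d => al (fun A =>
  odd_face x b A d ==> al (fun B => odd_face x a B d ==> al (fun D =>
  odd_face x a D b ==> al (fun w => ~~ [&&
        odd_face A d B w, odd_face A b D w & odd_face B a D w])))))))) by vm_compute.
have use P (k : 'I_3) : al P -> P k by move/allP; apply; rewrite mem_iota ltn_ord.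
move=> /and4P[h1 h2 h3 h4].
move: chk => /(use _ cx)/(use _ ca)/(use _ cb)/(use _ cd)/(use _ cA).
rewrite h1 => /(use _ cB); rewrite h2 => /(use _ cD); rewrite h3 => /(use _ cw).
by rewrite h4.
Qed.

(* Three vertices in the second layer and one in the third span a cube all of
   whose faces are negative; that signed graph needs four colors. *)
Lemma third_layer_empty : (2 < #|V|)%N -> W = set0.
Proof.
move=> V3; apply/eqP/set0Pn => -[w wW].
have := second_layer_full V3; move=> full.
have [A AV Aa] : exists2 v, v \in V & ~~ e v a by apply: full; rewrite !inE eqxx.
have [B BV Bb] : exists2 v, v \in V & ~~ e v b by apply: full; rewrite !inE eqxx orbT.
have [D DV Dd] : exists2 v, v \in V & ~~ e v d by apply: full; rewrite !inE eqxx !orbT.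
have [Ab Ad] : e A b /\ e A d.
  move: (second_layer_leaves AV) Aa.
  by case: (e A a) (e A b) (e A d) => [] [] [].
have [Ba Bd] : e B a /\ e B d.
  move: (second_layer_leaves BV) Bb.
  by case: (e B a) (e B b) (e B d) => [] [] [].
have [Da Db] : e D a /\ e D b.
  move: (second_layer_leaves DV) Dd.
  by case: (e D a) (e D b) (e D d) => [] [] [].
have [Aw Bw Dw] : [/\ e A w, e B w & e D w].
  by rewrite !(sym _ w) !third_layer_complete.
have nAB : A != B by apply: contraNneq Aa => ->.
have nAD : A != D by apply: contraNneq Aa => ->.
have nBD : B != D by apply: contraNneq Bb => ->.
have /and3P[/and3P[xa xb xd] /and3P[ab ad bd] /and3P[nab nad nbd]] := cl.
move: (wW); rewrite inE => /and3P[wo wV _].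
have : ~~ [|| e w a, e w b | e w d] by move: wV; rewrite inE wo.
rewrite !negb_or => /and3P[wa wb wd].
have out u : u \in V -> u \notin claw_set by rewrite inE => /andP[].
have outw u : u \in V -> u != w by move=> uV; apply: contraNneq wV => <-.
move: (wo); rewrite in_claw !inE !negb_or => /and4P[_ nwa nwb nwd].
have outl u : u \in V -> [&& u != a, u != b & u != d].
  by move/out; rewrite in_claw !inE !negb_or => /and4P[_ -> -> ->].
have clA : claw e A b d w.
  rewrite /claw Ab Ad Aw bd (sym b) wb (sym d) wd nbd.
  by rewrite ![_ == w]eq_sym nwb nwd.
have clB : claw e B a d w.
  rewrite /claw Ba Bd Bw ad (sym a) wa (sym d) wd nad.
  by rewrite ![_ == w]eq_sym nwa nwd.
have AB : B \notin [:: A; b; d; w].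
  have /and3P[_ h1 h2] := outl _ BV.
  by rewrite !inE !negb_or h1 h2 outw // eq_sym nAB.
have AD : D \notin [:: A; b; d; w].
  have /and3P[_ h1 h2] := outl _ DV.
  by rewrite !inE !negb_or h1 h2 outw // eq_sym nAD.
have BD : D \notin [:: B; a; d; w].
  have /and3P[h1 _ h2] := outl _ DV.
  by rewrite !inE !negb_or h1 h2 outw // eq_sym nBD.
have z u v : ~~ e u v -> wt u v = 0 by rewrite /weight => /negPf ->.
apply: (@cube_uncolorable (c x) (c a) (c b) (c d) (c A) (c B) (c D) (c w)).
have oA := out _ AV; have oB := out _ BV; have oD := out _ DV.
rewrite in_claw in oA; rewrite in_claw in oB; rewrite in_claw in oD.
(* Each face is an instance of the claw relation in which one leaf is missed: the other two products
   cancel, which makes the 4-cycle odd. *)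
apply/and5P; split; last (apply/andP; split); apply: odd_face_weight => //.
- by have [_] := claw_rule good cl oA; rewrite (z _ _ Aa) mulr0 add0r.
- by have [_] := claw_rule good cl oB; rewrite (z _ _ Bb) mulr0 addr0.
- by have [_] := claw_rule good cl oD; rewrite (z _ _ Dd) mulr0 addr0.
- by have [_] := claw_rule good clA AB; rewrite (z _ _ Bb) mulr0 add0r.
- by have [_] := claw_rule good clA AD; rewrite (z _ _ Dd) mulr0 addr0.
- by have [_] := claw_rule good clB BD; rewrite (z _ _ Dd) mulr0 addr0.
Qed.

(** * Eigenvectors for [sqrt 3] on the component *)

Section Eigenvector.
Variables (R : rcfType) (y : 'I_n -> R).
Local Notation t := (Num.sqrt (3 : R)).
Hypothesis yE : forall j, t * y j = \sum_i y i * (wt i j)%:~R.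

Let t3 : t ^+ 2 = 3. Proof. by rewrite sqr_sqrtr. Qed.
Let t0 : t != 0. Proof. by rewrite sqrtr_eq0 -ltNge. Qed.

Let support_sum j (s : seq 'I_n) : uniq s ->
  (forall i, i \notin s -> e i j -> y i = 0) ->
  t * y j = \sum_(i <- s) y i * (wt i j)%:~R.
Proof.
move=> us supp; rewrite yE (bigID [in s]) /= -big_uniq // [X in _ + X]big1 ?addr0 //.
move=> i /supp yi; rewrite /weight; case: ifP => [/yi ->|]; first by rewrite mul0r.
by rewrite mulr0.
Qed.

Let isolated_zero j : (forall i, e i j -> y i = 0) -> y j = 0.
Proof.
move=> supp; apply: (mulfI t0); rewrite (@support_sum j [::]) // ?big_nil ?mulr0 //.
by move=> i _; exact: supp.
Qed.

Let leaf_nb p i : p \in [:: a; b; d] -> e i p -> (i == x) || (i \in V).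
Proof.
move=> pl ip; have [iK|iK] := boolP (i \in claw_set); last first.
  by rewrite inE iK; move: pl ip; rewrite !inE => /or3P[] /eqP -> ->; rewrite ?orbT.
have /and3P[_ /and3P[ab ad bd] _] := cl; apply/orP; left.
move: iK pl ip; rewrite in_claw !inE => /or4P[] /eqP -> //;
  by case/or3P => /eqP ->; rewrite ?(edge_irr good) // ?(negPf ab) ?(negPf ad) ?(negPf bd)
       // sym ?(negPf ab) ?(negPf ad) ?(negPf bd).
Qed.

(** Leaves and third-layer vertices have all their neighbors among [x] and the second layer, so the
    eigenvector equation there has right-hand side zero. *)
Lemma vanish_on_layers : y x = 0 -> {in V, forall v, y v = 0} ->
  {in claw_closure, forall i, y i = 0}.
Proof.
move=> yx yV i; rewrite in_closure => /or3P[|/yV //|iW]; last first.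
  apply: isolated_zero => j ji; apply/yV/(third_layer_nb iW); by rewrite sym.
rewrite in_claw in_cons => /predU1P[-> //|il].
by apply: isolated_zero => j /(leaf_nb il)/orP[/eqP->|/yV].
Qed.

(** Each leaf [p] satisfies [t * y p = y v * wt v p]. Hence the equation at [v0], multiplied by [t],
    reads [y v * (m + k * t) = 0] with integers [m] and [k]. As [v] and [v0] share exactly one leaf,
    [m] is a sign, so [m + k * t] is nonzero by irrationality. *)
Lemma vanish_on_last v0 v : W = set0 -> v0 \in V -> v \in V -> v0 != v ->
  y x = 0 -> {in V, forall u, u != v -> y u = 0} -> y v = 0.
Proof.
move=> W0 v0V vV nv yx yV.
have leaf p : p \in [:: a; b; d] -> t * y p = y v * (wt v p)%:~R.
  move=> pl; rewrite (@support_sum p [:: v]) ?big_seq1 // => i.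
  by rewrite inE => iv /(leaf_nb pl)/orP[/eqP->|/yV->].
have := claw_uniq cl; rewrite /= !inE !negb_or !andbT.
move=> /and3P[_ /andP[nab nad] nbd].
have vo : v \notin claw_set by move: vV; rewrite inE => /andP[].
have us : uniq [:: a; b; d; v].
  move: vo; rewrite in_claw /= !inE !negb_or nab nad nbd ![v == _]eq_sym.
  by move=> /and4P[_ -> -> ->].
have := @support_sum v0 _ us; rewrite yV // mulr0 => H.
have {H} : 0 = \sum_(i <- [:: a; b; d; v]) y i * (wt i v0)%:~R.
  apply: H => i; rewrite !inE !negb_or => /and4P[ia ib id iv] iv0.
  have [iK|iK] := boolP (i \in claw_set).
    by move: iK; rewrite in_claw !inE (negPf ia) (negPf ib) (negPf id) !orbF => /eqP ->.
  have [/yV -> //|iV] := boolP (i \in V).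
  have : i \in W by rewrite inE iK iV; apply/existsP; exists v0; rewrite v0V.
  by rewrite W0 inE.
rewrite !big_cons big_nil addr0 => /(congr1 ( *%R t)); rewrite mulr0 !mulrDr !mulrA.
rewrite (leaf a) ?(leaf b) ?(leaf d) ?inE ?eqxx ?orbT // => /esym sum0.
apply/eqP; apply: contraT => yv0.
have : (wt v a * wt a v0 + wt v b * wt b v0 + wt v d * wt d v0)%:~R
       + (wt v v0)%:~R * t = 0.
  by apply: (mulfI yv0); rewrite mulr0 -[RHS]sum0 !rmorphD !rmorphM /=; ring.
move=> /(sqrt3_free_int t3)[z0 _]; move: z0.
have := second_layer_share v0V vV nv.
move: (second_layer_leaves v0V) (second_layer_leaves vV).
rewrite /weight !(sym _ v0).
case: (e v0 a) (e v0 b) (e v0 d) (e v a) (e v b) (e v d)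
   => [] [] [] [] [] [] //= _ _ _; do ?case: (_ == _) => //=.
Qed.
End Eigenvector.

Lemma claw_determined (R : rcfType) : exists S C : {set 'I_n},
  [/\ (0 < #|C|)%N, (7 * #|S| <= 3 * #|C|)%N,
      forall i j, i \in C -> e i j -> j \in C &
      forall y : 'I_n -> R,
        (forall j, Num.sqrt 3 * y j = \sum_i y i * (wt i j)%:~R) ->
        {in S, forall i, y i = 0} -> {in C, forall i, y i = 0}].
Proof.
have K4 : #|claw_set| = 4%N.
  transitivity #|[:: x; a; b; d]|; last by rewrite (card_uniqP (claw_uniq cl)).
  by apply: eq_card => i; rewrite in_claw.
have KV : [disjoint claw_set & V].
  rewrite disjoint_sym disjoint_subset; apply/subsetP => i.
  by rewrite [i \in V]inE => /andP[].
have KVW : [disjoint claw_set :|: V & W].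
  rewrite disjoint_sym disjoint_subset; apply/subsetP => i.
  rewrite [i \in W]inE => /and3P[iK iV _];
  have : i \notin claw_set :|: V by rewrite [_ \in _ :|: _]in_setU (negPf iK) (negPf iV).
  by [].
have cardC : #|claw_closure| = (4 + #|V| + #|W|)%N.
  by rewrite cardsU (disjoint_setI0 KVW) cardsU (disjoint_setI0 KV) !cards0 !subn0 K4.
have xV : x \notin V by rewrite inE in_claw inE eqxx.
have V3 := card_second_layer; have W0 := third_layer_empty.
have [Vle|Vgt] := boolP ((#|V| <= 1)%N || (W != set0)).
  (* A nonempty third layer leaves at most two vertices in the second, so [S] is small enough;
     layers of sizes 2 and 1 give exactly 3 vertices out of 7. *)
  exists (x |: V), claw_closure; split.
  - by rewrite cardC.
  - rewrite cardsU1 xV cardC; case/orP: Vle => [|Wn0]; first by move: #|V| #|W| => k l /=; lia.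
    have Wgt : (0 < #|W|)%N by rewrite card_gt0.
    have : (#|V| <= 2)%N by rewrite leqNgt; apply: contra Wn0 => /W0/eqP.
    by move: #|V| #|W| Wgt => k l /=; lia.
  - exact: claw_closed.
  - move=> y yE yS; apply: vanish_on_layers yE _ _.
      by apply: yS; rewrite !inE eqxx.
    by move=> v vV; apply: yS; rewrite in_setU vV orbT.
move: Vgt; rewrite negb_or -ltnNge negbK => /andP[/card_gt1P[v0 [v [v0V vV nv]]] /eqP WE].
(* Here the third layer is empty and the second has two or three vertices, so [vanish_on_last] saves
   one of them; three give exactly 3 out of 7. *)
exists (x |: (V :\ v)), claw_closure; split.
- by rewrite cardC.
- have := cardsD1 v V; rewrite vV => VE.
  rewrite cardsU1 cardC WE cards0 in_setD1 (negPf xV) andbF /=.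
  by move: V3 VE; rewrite -/V; move: #|V| #|V :\ v| => k l; lia.
- exact: claw_closed.
- move=> y yE yS.
  have yx : y x = 0 by apply: yS; rewrite !inE eqxx.
  have yV : {in V, forall u, u != v -> y u = 0}.
    by move=> u uV uv; apply: yS; rewrite in_setU in_setD1 uv uV orbT.
  apply: vanish_on_layers => // u uV; have [->|uv] := eqVneq u v; last exact: yV.
  exact: (vanish_on_last yE WE v0V vV nv).
Qed.
End ClawComponent.

(** * Removing a component and induction on the number of vertices *)

Section InducedBound.
Variables (n : nat) (e : rel 'I_n) (c : 'I_n -> 'I_3).

Lemma locally_bounded_induced m (f : 'I_m -> 'I_n) : injective f ->
  locally_bounded e c -> locally_bounded (relpre f e) (c \o f).
Proof.
move=> fI [sym irr tri clr]; split=> /=.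
- by move=> i j; exact: sym.
- by move=> i; exact: irr.
- by move=> i j k; exact: tri.
- move=> x a b d u cl uo; apply: (clr (f x) (f a) (f b) (f d) (f u)).
    by move: cl; rewrite /claw /= !(inj_eq fI).
  by move: uo; rewrite !inE !(inj_eq fI).
Qed.

(** Restriction to [S] has rank at most the size of [S]. An eigenvector in its kernel vanishes on
    [C], hence extends by zero an eigenvector of the submatrix on the complement. *)
Lemma rank_eigenspace_determined (F : fieldType) (A : 'M[F]_n) (t : F) (S C : {set 'I_n}) :
  let f := @enum_val _ (mem (~: C)) in
  (forall y : 'I_n -> F, (forall j, t * y j = \sum_i y i * A i j) ->
     {in S, forall i, y i = 0} -> {in C, forall i, y i = 0}) ->
  (\rank (eigenspace A t) <= #|S| + \rank (eigenspace (mxsub f f A) t))%N.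
Proof.
move=> f det; set E := eigenspace A t.
pose D : 'M[F]_n := diag_mx (\row_i (i \in S)%:R).
have rD : \rank D = #|S|.
  rewrite mxrank_diag; apply: eq_card => i; rewrite inE mxE.
  by case: (i \in S); rewrite ?oner_eq0 ?eqxx.
rewrite -(mxrank_mul_ker E D) leq_add //; first by rewrite -rD mxrankM_maxr.
(* Right multiplication by [G] is extension by zero. *)
pose G : 'M[F]_(#|~: C|, n) := rowsub f 1%:M.
suff /mxrankS/leq_trans : (E :&: kermx D <= eigenspace (mxsub f f A) t *m G)%MS.
  by apply; exact: mxrankM_maxl.
suff step (y : 'rV_n) : (y <= E :&: kermx D)%MS ->
    (y <= eigenspace (mxsub f f A) t *m G)%MS.
  by apply/row_subP => k; apply: step (row_sub _ _).
rewrite sub_capmx => /andP[/eigenspaceP yA /sub_kermxP yD].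
have yE j : t * y 0 j = \sum_i y 0 i * A i j.
  by have /rowP/(_ j) := yA; rewrite !mxE => <-.
have yS : {in S, forall i, y 0 i = 0}.
  by move=> i iS; have /rowP/(_ i) := yD; rewrite mul_mx_diag !mxE iS mulr1.
have yC := det (fun i => y 0 i) yE yS.
have yG : y = colsub f y *m G.
  apply/rowP => j; rewrite [RHS]mxE; have [jC|jC] := boolP (j \in C).
    rewrite yC // big1 // => i _; rewrite !mxE.
    have := enum_valP i; rewrite inE -/(f i); case: eqP => [->|_ _]; last by rewrite mulr0.
    by rewrite jC.
  have jC' : j \in ~: C by rewrite inE.
  rewrite (bigD1 (enum_rank_in jC' j)) //= big1 ?addr0 => [|i ne].
    by rewrite !mxE /f enum_rankK_in // eqxx mulr1.
  rewrite !mxE; case: eqP => [E1|_]; last by rewrite mulr0.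
  by case/eqP: ne; apply: enum_val_inj; rewrite enum_rankK_in.
rewrite yG submxMr //; apply/eigenspaceP/rowP => j; rewrite !mxE yE; apply/esym.
rewrite (bigID [in ~: C]) /= [X in _ + X]big1 ?addr0 => [|i]; last first.
  by rewrite inE negbK => /yC ->; rewrite mul0r.
by rewrite big_enum_val; apply: eq_bigr => i _; rewrite !mxE.
Qed.
End InducedBound.

Lemma locally_bounded_rank (R : rcfType) n (e : rel 'I_n) (c : 'I_n -> 'I_3) :
  locally_bounded e c ->
  (7 * \rank (eigenspace (weight_mx e c R) (Num.sqrt 3)) <= 3 * n)%N.
Proof.
have [N] := ubnP n; elim: N n e c => // N IH n e c nN good.
have [cf|] := boolP [forall x, forall a, forall b, forall d, ~~ claw e x a b d].
  apply: clawfree_rank => // x a b d.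
  by move/forallP/(_ x)/forallP/(_ a)/forallP/(_ b)/forallP/(_ d): cf.
rewrite negb_forall => /existsP[x]; rewrite negb_forall => /existsP[a].
rewrite negb_forall => /existsP[b]; rewrite negb_forall => /existsP[d].
rewrite negbK => cl.
have [S [C [C0 SC clos det]]] := claw_determined good cl R.
pose f := @enum_val _ (mem (~: C)).
have cardC : (#|C| + #|~: C| = n)%N by rewrite cardsC card_ord.
have mN : (#|~: C| < N)%N by move: cardC C0 nN; move: #|C| #|~: C| => k l; lia.
have := IH _ _ _ mN (locally_bounded_induced (@enum_val_inj _ (mem (~: C))) good).
have -> : weight_mx (relpre f e) (c \o f) R = mxsub f f (weight_mx e c R).
  by apply/matrixP => i j; rewrite !mxE.
have : (\rank (eigenspace (weight_mx e c R) (Num.sqrt 3))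
   <= #|S| + \rank (eigenspace (mxsub f f (weight_mx e c R)) (Num.sqrt 3)))%N.
  apply: rank_eigenspace_determined => y yE; apply: det => j.
  by rewrite yE; apply: eq_bigr => i _; rewrite mxE.
move=> h1 h2; rewrite -[in leqRHS]cardC mulnDr; apply: leq_trans (leq_add SC h2).
by rewrite -mulnDr leq_mul2l.
Qed.

(** * Colorings, induced subgraphs and the forbidden family *)

Lemma chi_le_coloring n (G : signed_graph n) p : chi_le G p ->
  exists c : 'I_n -> 'I_p, forall i j,
    (neg_edge G i j -> c i != c j) /\ (pos_edge G i j -> c i == c j).
Proof.
rewrite /chi_le /chi; case: pselect => // ex; case: ex_minnP => t /existsP[c cP] _ tp.
exists (widen_ord tp \o c) => i j; move/forallP/(_ i)/forallP/(_ j): cP => /=.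
by move=> /andP[/implyP neg /implyP pos]; split=> [/neg|/pos].
Qed.

Definition edge n (G : signed_graph n) : rel 'I_n := fun i j => label G (i, j) != None.

Lemma label_sym n (G : signed_graph n) i j : label G (i, j) = label G (j, i).
Proof. by case: G => l /= /andP[_ /forallP/(_ i)/forallP/(_ j)/eqP]. Qed.

Lemma label_irr n (G : signed_graph n) i : label G (i, i) = None.
Proof. by case: G => l /= /andP[/forallP/(_ i)/eqP]. Qed.

Section Induced.
Variables (n : nat) (G : signed_graph n) (k : nat) (f : 'I_k -> 'I_n).

Definition induced_label := [ffun ij : 'I_k * 'I_k => label G (f ij.1, f ij.2)].

Lemma induced_label_simple : simple_labeling induced_label.
Proof.
apply/andP; split; first by apply/forallP => i; rewrite ffunE label_irr.
by apply/forallP => i; apply/forallP => j; rewrite !ffunE label_sym.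
Qed.

Definition induced : signed_graph k := SignedGraph induced_label_simple.

Lemma induced_in_induced : injective f -> induced_in induced G.
Proof.
move=> fI; apply/existsP; exists (finfun f); apply/andP; split.
  by apply/injectiveP => i j; rewrite !ffunE => /fI.
by apply/forallP => i; apply/forallP => j; rewrite /= !ffunE.
Qed.

Lemma signed_adj_induced (R : nzRingType) :
  signed_adj R induced = mxsub f f (signed_adj R G).
Proof. by apply/matrixP => i j; rewrite !mxE /pos_edge /neg_edge /= ffunE. Qed.
End Induced.

(** All labeled graphs are listed, so an induced subgraph is literally a member and no isomorphism
    has to be transported. *)
Definition small_graphs_above (R : rcfType) (a : R) m : seq {k & signed_graph k} :=
  flatten [seq [seq Tagged signed_graph G | G <- enum {: signed_graph k} & a < eigval R G 1]
          | k <- iota 0 m.+1].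

Lemma small_graphs_aboveP (R : rcfType) (a : R) m (H : {k & signed_graph k}) :
  reflect ((tag H <= m)%N /\ a < eigval R (tagged H) 1) (H \in small_graphs_above a m).
Proof.
apply: (iffP flatten_mapP) => [[k]|[]].
  rewrite mem_iota ltnS => km /mapP[G]; rewrite mem_filter => /andP[aG _] ->.
  by [].
case: H => k G km aG; exists k; first by rewrite mem_iota ltnS.
by apply/mapP; exists G; rewrite // mem_filter aG mem_enum.
Qed.

(** * Test vectors on at most five vertices *)

Section Forbidden.
Variables (R : rcfType) (n : nat) (G : signed_graph n) (c : 'I_n -> 'I_3).
Local Notation t := (Num.sqrt (3 : R)).
Local Notation e := (edge G).
Local Notation wt := (weight e c).
Hypothesis cP : forall i j, (neg_edge G i j -> c i != c j) /\ (pos_edge G i j -> c i == c j).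
Hypothesis free : forall H, H \in small_graphs_above t 5 -> ~~ induced_in (tagged H) G.

Lemma signed_adj_weight (S : nzRingType) : signed_adj S G = weight_mx e c S.
Proof.
apply/matrixP => i j; rewrite !mxE /weight /edge.
have [neg pos] := cP i j; move: neg pos; rewrite /pos_edge /neg_edge.
case: (label G (i, j)) => [[]|] //= neg pos; first by rewrite pos.
by rewrite (negPf (neg isT)).
Qed.

Let t3 : t ^+ 2 = 3. Proof. by rewrite sqr_sqrtr. Qed.
Let t_ge0 : 0 <= t. Proof. exact: sqrtr_ge0. Qed.
Let t2 : t < 2. Proof. by have := t3; have := t_ge0; nra. Qed.

Let wtC i j : wt i j = wt j i.
Proof. by rewrite /weight /edge label_sym (eq_sym (c i)). Qed.

Let wt0 i : wt i i = 0. Proof. by rewrite /weight /edge label_irr. Qed.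

(** Otherwise [y] restricted to [s] would be a test vector placing the subgraph induced on [s] in
    the forbidden family. *)
Let form_bound (s : seq 'I_n) (y : 'I_n -> R) : uniq s -> (size s <= 5)%N ->
  \sum_(i <- s) \sum_(j <- s) y i * (wt i j)%:~R * y j <= t * \sum_(i <- s) y i ^+ 2.
Proof.
move=> us s5; pose f := tnth (in_tuple s).
have fI : injective f by exact/(tuple_uniqP (in_tuple s)).
pose H : {k & signed_graph k} := Tagged signed_graph (induced G f).
have : H \notin small_graphs_above t 5.
  by apply: contraL (induced_in_induced G fI) => /free.
move/small_graphs_aboveP => notin; rewrite leNgt; apply/negP => big; apply: notin.
split=> //=; pose x : 'rV[R]_(size s) := \row_i y (f i).
apply: (@eigval1_gt_form _ _ _ _ x); rewrite signed_adj_induced signed_adj_weight.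
move: big; congr (_ * _ < _).
  by rewrite big_tnth mxE; apply: eq_bigr => i _; rewrite !mxE expr2.
rewrite big_tnth mxE [RHS](eq_bigr (fun j => \sum_i y (f i) * (wt (f i) (f j))%:~R * y (f j))).
  by rewrite [RHS]exchange_big; apply: eq_bigr => i _; rewrite [LHS]big_tnth.
by move=> j _; rewrite !mxE big_distrl; apply: eq_bigr => i _; rewrite !mxE.
Qed.

Let wt_sqr i j : e i j -> (wt i j)%:~R ^+ 2 = 1 :> R.
Proof. by rewrite /weight => ->; case: (_ == _); rewrite ?expr1n // sqrrN expr1n. Qed.

Let edge_neq i j : e i j -> i != j.
Proof. by apply: contraL => /eqP <-; rewrite /edge label_irr. Qed.

(** If [i] and [j] had the same color, [k] would be joined to both with the same sign [w], and the
    vector [(1, 1, w)] would have Rayleigh quotient 2, above [sqrt 3]. *)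
Let rainbow i j k : e i j -> e j k -> e i k -> c i != c j.
Proof.
move=> ij jk ik; apply/negP => /eqP cij.
pose y l : R := if l == k then (wt i k)%:~R else 1.
have us : uniq [:: i; j; k] by rewrite /= !inE !negb_or !edge_neq.
have := form_bound y us isT; rewrite !big_cons !big_nil !addr0 /y eqxx.
rewrite (negPf (edge_neq ik)) (negPf (edge_neq jk)) !wt0 (wtC j i) (wtC k i) (wtC k j).
have -> : wt j k = wt i k by rewrite /weight ik jk cij.
have -> : wt i j = 1 by rewrite /weight ij cij eqxx.
by have := wt_sqr ik; move: ((wt i k)%:~R : R) => w w2; have := t2; nra.
Qed.

(* The claw has largest eigenvalue [sqrt 3], so another vertex must be orthogonal to
   its eigenvector; the irrationality of [sqrt 3] splits this into two conditions. *)
Let claw_orthogonal x a b d u : claw e x a b d -> u \notin [:: x; a; b; d] ->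
  ~~ e x u /\ wt x a * wt u a + wt x b * wt u b + wt x d * wt u d = 0.
Proof.
move=> cl uo; have /and3P[/and3P[xa xb xd] /and3P[ab ad bd] /and3P[nab nad nbd]] := cl.
pose S := wt x a * wt u a + wt x b * wt u b + wt x d * wt u d.
(* [z] pairs the weights at [u] with the claw eigenvector, and it also serves as the coordinate at
   [u] of the test vector. *)
pose z : R := S%:~R + (wt x u)%:~R * t.
pose y l : R := if l == x then t else if l == u then z else (wt x l)%:~R.
move: (uo); rewrite !inE !negb_or => /and4P[ux ua ub ud].
have us : uniq [:: x; a; b; d; u].
  rewrite /= !inE !negb_or !(edge_neq xa) !(edge_neq xb) !(edge_neq xd) nab nad nbd.
  by rewrite ![_ == u]eq_sym ux ua ub ud.
have yx : y x = t by rewrite /y eqxx.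
have yu : y u = z by rewrite /y (negPf ux) eqxx.
have yl l : e x l -> u != l -> y l = (wt x l)%:~R.
  by move=> xl ul; rewrite /y eq_sym (negPf (edge_neq xl)) eq_sym (negPf ul).
have w0 l m : ~~ e l m -> wt l m = 0 by rewrite /weight => /negPf ->.
have := form_bound y us isT; rewrite !big_cons !big_nil !addr0 yx yu !yl //.
rewrite !wt0 (wtC a x) (wtC b x) (wtC d x) (wtC u x) (wtC b a) (wtC d a) (wtC d b).
rewrite (w0 _ _ ab) (w0 _ _ ad) (w0 _ _ bd) (wtC a u) (wtC b u) (wtC d u).
have zE : z = (wt x a)%:~R * (wt u a)%:~R + (wt x b)%:~R * (wt u b)%:~R
              + (wt x d)%:~R * (wt u d)%:~R + (wt x u)%:~R * t.
  by rewrite /z /S !rmorphD !rmorphM.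
have := wt_sqr xa; have := wt_sqr xb; have := wt_sqr xd.
move: zE; set wa : R := (wt x a)%:~R; set wb : R := (wt x b)%:~R.
set wd : R := (wt x d)%:~R; set va : R := (wt u a)%:~R; set vb : R := (wt u b)%:~R.
set vd : R := (wt u d)%:~R; set wu : R := (wt x u)%:~R => zE wd2 wb2 wa2 bnd.
have : 2 * t * (wa ^+ 2 + wb ^+ 2 + wd ^+ 2) + 2 * z * z
    <= t * (t ^+ 2 + (wa ^+ 2 + (wb ^+ 2 + (wd ^+ 2 + z ^+ 2)))).
  apply: le_trans bnd; rewrite {2}zE le_eqVlt; apply/orP; left; apply/eqP.
  by rewrite mulr0z; ring.
rewrite wa2 wb2 wd2 t3 => ineq.
(* The inequality reduces to [2 z^2 <= t z^2], and [t < 2]. *)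
have z0 : z = 0.
  apply/eqP; rewrite -sqrf_eq0 eq_le sqr_ge0 andbT.
  by have := sqr_ge0 z; have := t2; rewrite expr2 in ineq *; nra.
have [S0 xu0] := sqrt3_free_int t3 z0; split=> //.
by move/eqP: xu0; rewrite /weight; case: (e x u) => //; case: (c x == c u).
Qed.

Lemma free_locally_bounded : locally_bounded e c.
Proof.
split=> [i j|i|i j k|x a b d u].
- by rewrite /edge label_sym.
- by rewrite /edge label_irr.
- exact: rainbow.
- exact: claw_orthogonal.
Qed.
End Forbidden.

Theorem theorem5p1 (R : realType) :
  exists Hs : seq {k & signed_graph k},
    (forall H : {k & signed_graph k},
       H \in Hs -> Num.sqrt (3 : R) < eigval R (tagged H) 1) /\
    (forall N : nat,
       (max_mult 3 Hs (Num.sqrt (3 : R)) N)%:R <= 3 * N%:R / 7 :> R).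
Proof.
exists (small_graphs_above (Num.sqrt (3 : R)) 5); split=> [H /small_graphs_aboveP[]//|N].
(* Over the naturals the maximum can be bounded term by term; a graph on [n <= N] vertices obeys the
   bound with [n] in place of [N]. *)
have : (7 * max_mult 3 (small_graphs_above (Num.sqrt (3 : R)) 5) (Num.sqrt (3 : R)) N <= 3 * N)%N.
  rewrite mulnC -leq_divRL //; apply/bigmax_leqP => n _; apply/bigmax_leqP => G.
  rewrite leq_divRL // mulnC => /and3P[/allP free /chi_le_coloring[c cP] _].
  have lb := free_locally_bounded cP free.
  apply: leq_trans (_ : 3 * n <= _)%N; last by rewrite leq_mul2l -ltnS ltn_ord.
  apply: leq_trans (locally_bounded_rank R lb).
  by rewrite leq_mul2l -(signed_adj_weight cP) mult_le_rank.
by rewrite -(ler_nat R) !natrM => le; rewrite ler_pdivlMr // mulrC.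
Qed.
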